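(* Let $n,k$ be integers with $1\le k\le n$. Let $E\subseteq\mathbb{R}^n$ and let $F$ denote the union of $E$ with every (affine) $k$-plane in $\mathbb{R}^n$ that intersects $E$ in a set of positive measure. Then either $E=F$, or $$\dim_P(F)\le 2\dim_P(E)-k.$$
   Context: $\dim_P$ denotes packing dimension. ''Positive measure'' for a subset of a $k$-plane means positive $k$-dimensional Lebesgue measure on that $k$-plane. *)

(* Defs.v *)
From HB Require Import structures.
From mathcomp Require Import all_boot all_order all_algebra.
From mathcomp Require Import all_classical all_reals all_analysis.

Set Implicit Arguments.
Unset Strict Implicit.
Unset Printing Implicit Defensive.

Import Order.TTheory GRing.Theory Num.Theory.
Import numFieldNormedType.Exports.

Local Open Scope classical_set_scope.
Local Open Scope ring_scope.

(* The points of R^n are the row vectors 'rV[R]_n.  The library norm on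
   matrices is the sup norm, hence the explicit Euclidean norm. *)
Definition enorm (R : realType) (n : nat) (x : 'rV[R]_n) : R :=
  Num.sqrt (\sum_(i < n) x 0 i ^+ 2).

Definition eball (R : realType) (n : nat) (c : 'rV[R]_n) (r : R) :
    set 'rV[R]_n :=
  [set x | enorm (x - c) <= r].

(* Smallest number of closed balls of radius r that cover A, +oo if there is
   no finite cover. *)
Definition covering_number (R : realType) (n : nat) (A : set 'rV[R]_n)
    (r : R) : \bar R :=
  ereal_inf [set (m%:R)%:E | m in
    [set m : nat | exists c : 'I_m -> 'rV[R]_n,
        A `<=` \bigcup_(i in [set: 'I_m]) eball (c i) r]].

(* limsup_{r -> 0+} log N(A, r) / log (1 / r).  Since lne 0 = -oo, the empty
   set has dimension -oo. *)
Definition upper_box_dim (R : realType) (n : nat) (A : set 'rV[R]_n) :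
    \bar R :=
  limf_esup (fun r : R => (lne (covering_number A r) * ((ln r^-1)^-1)%:E)%E)
            (0 : R)^'+.

(* Packing dimension as modified upper Minkowski dimension: the infimum of
   sup_i (upper box dimension of B_i) over countable covers of A by bounded
   sets B_i. *)
Definition packing_dim (R : realType) (n : nat) (A : set 'rV[R]_n) :
    \bar R :=
  ereal_inf [set ereal_sup (range (fun i => upper_box_dim (B i))) | B in
    [set B : nat -> set 'rV[R]_n |
        (forall i, bounded_set (B i)) /\ A `<=` \bigcup_i B i]].

Definition box (R : realType) (k : nat) (a b : 'rV[R]_k) : set 'rV[R]_k :=
  [set x | forall j, a 0 j <= x 0 j <= b 0 j].

(* Lebesgue outer measure on R^k: it is defined on all sets, and agrees with
   Lebesgue measure on the Lebesgue measurable ones. *)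
Definition lebesgue_outer (R : realType) (k : nat) (A : set 'rV[R]_k) :
    \bar R :=
  ereal_inf [set (\sum_(0 <= i <oo)
                    (\prod_(j < k) (ab.2 i 0 j - ab.1 i 0 j))%:E)%E | ab in
    [set ab : (nat -> 'rV[R]_k) * (nat -> 'rV[R]_k) |
        (forall i j, ab.1 i 0 j <= ab.2 i 0 j) /\
        A `<=` \bigcup_i box (ab.1 i) (ab.2 i)]].

Definition affine_param (R : realType) (n k : nat) (p : 'rV[R]_n)
    (V : 'M[R]_(k, n)) (t : 'rV[R]_k) : 'rV[R]_n :=
  p + t *m V.

Definition is_kplane (R : realType) (n k : nat) (P : set 'rV[R]_n) : Prop :=
  exists (p : 'rV[R]_n) (V : 'M[R]_(k, n)),
    row_free V /\ P = range (affine_param p V).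

(* A has positive k-dimensional Lebesgue (outer) measure on the k-plane P.  The
   rows of V are orthonormal, so that affine_param p V is an isometry of R^k
   onto P; the measure does not depend on the choice of p and V. *)
Definition positive_measure_on (R : realType) (n k : nat)
    (P A : set 'rV[R]_n) : Prop :=
  exists (p : 'rV[R]_n) (V : 'M[R]_(k, n)),
    [/\ V *m V^T = 1%:M, P = range (affine_param p V) &
        (0 < lebesgue_outer (affine_param p V @^-1` A))%E].

Definition plane_extension (R : realType) (n k : nat) (E : set 'rV[R]_n) :
    set 'rV[R]_n :=
  E `|` \bigcup_(P in [set P | is_kplane k P /\
                               positive_measure_on k P (E `&` P)]) P.

(* Main.v *)
(* Cover E by countably many bounded sets B.  A k-plane P meeting E in positive
   outer measure meets some B in outer measure at least c > 0, so for
   x in P the set B `&` P contains about r^-k points that are r-separated.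
   Dilate this set about x by the ratios 1 + i/M, i < M: for M large, depending
   only on c and on the size of B, the dilates cannot all be almost disjoint at
   scale r, which gives at least r^-k pairs y, z in B with
   l (y - x) = l' (z - x) + O(r) for two distinct ratios l, l'.  Conversely l, l'
   and the balls of radius r containing y and z determine x up to O(r).  Hence if
   N balls of radius r cover B, then O(N^2 r^k) balls of radius O(r) cover the
   points x under consideration, whose upper box dimension is thus at most
   2 dim B - k.  If E <> F then some such P exists, so dim E >= k and E itself
   obeys the bound. *)

Require Import Defs.
From mathcomp Require Import all_boot all_order all_algebra.
From mathcomp Require Import all_classical all_reals all_analysis.
From mathcomp Require Import ring lra.

Set Implicit Arguments.
Unset Strict Implicit.
Unset Printing Implicit Defensive.

Import Order.TTheory GRing.Theory Num.Theory.
Import numFieldNormedType.Exports.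

Local Open Scope classical_set_scope.
Local Open Scope ring_scope.

(** * Sup norm against Euclidean norm, and isometric embeddings *)

Lemma ge_entry_rV_norm (R : realType) n (x : 'rV[R]_n) j : `|x 0 j| <= `|x|.
Proof.
rewrite /Num.norm /= mx_normrE.
exact: (le_bigmax _ (fun ij : 'I_1 * 'I_n => `|x ij.1 ij.2|) (0, j)).
Qed.

Lemma rV_norm_le (R : realType) n (x : 'rV[R]_n) c :
  0 <= c -> (forall j, `|x 0 j| <= c) -> `|x| <= c.
Proof.
move=> c0 xc; rewrite /Num.norm /= mx_normrE.
by apply: bigmax_le => // -[i j] _ /=; rewrite ord1.
Qed.

Lemma enorm_ge0 (R : realType) n (x : 'rV[R]_n) : 0 <= enorm x.
Proof. exact: sqrtr_ge0. Qed.

Lemma norm_le_enorm (R : realType) n (x : 'rV[R]_n) : `|x| <= enorm x.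
Proof.
apply: rV_norm_le (enorm_ge0 x) _ => j.
rewrite -sqrtr_sqr ler_wsqrtr// (bigD1 j)//= lerDl.
by apply: sumr_ge0 => i _; exact: sqr_ge0.
Qed.

Lemma enorm_le_norm (R : realType) n (x : 'rV[R]_n) : enorm x <= n%:R * `|x|.
Proof.
case: n x => [|n] x; first by rewrite /enorm big_ord0 sqrtr0 mul0r.
have n1 : 1 <= n.+1%:R :> R by rewrite ler1n.
have nx0 : 0 <= n.+1%:R * `|x| by rewrite mulr_ge0.
rewrite -(ger0_norm nx0) -sqrtr_sqr ler_wsqrtr//.
apply: (@le_trans _ _ (\sum_(i < n.+1) `|x| ^+ 2)).
  apply: ler_sum => i _; rewrite -[leLHS]real_normK ?num_real//.
  by rewrite lerXn2r ?nnegrE//; exact: ge_entry_rV_norm.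
rewrite sumr_const card_ord -(mulr_natl (`|x| ^+ 2)) exprMn.
rewrite ler_wpM2r ?sqr_ge0//.
by rewrite expr2 ler_peMl.
Qed.

Lemma enorm_mul_orthonormal (R : realType) n k (V : 'M[R]_(k, n))
    (t : 'rV[R]_k) :
  V *m V^T = 1%:M -> enorm (t *m V) = enorm t.
Proof.
have enormE m (y : 'rV[R]_m) : enorm y = Num.sqrt ((y *m y^T) 0 0).
  by rewrite mxE; congr Num.sqrt; apply: eq_bigr => i _; rewrite mxE expr2.
by move=> VV; rewrite !enormE trmx_mul mulmxA -(mulmxA t) VV mulmx1.
Qed.

Lemma norm_mul_orthonormal_le (R : realType) n k (V : 'M[R]_(k, n))
    (t : 'rV[R]_k) :
  V *m V^T = 1%:M -> `|t *m V| <= k%:R * `|t|.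
Proof.
move=> VV; apply: le_trans (norm_le_enorm _) _.
by rewrite enorm_mul_orthonormal// enorm_le_norm.
Qed.

Lemma norm_le_mul_orthonormal (R : realType) n k (V : 'M[R]_(k, n))
    (t : 'rV[R]_k) :
  V *m V^T = 1%:M -> `|t| <= n%:R * `|t *m V|.
Proof.
move=> VV; apply: le_trans (norm_le_enorm _) _.
by rewrite -(enorm_mul_orthonormal _ VV) enorm_le_norm.
Qed.

Lemma eball_norm (R : realType) n (c x y : 'rV[R]_n) r :
  eball c r x -> eball c r y -> `|x - y| <= 2 * r.
Proof.
move=> /(le_trans (norm_le_enorm _)) xc /(le_trans (norm_le_enorm _)) yc.
rewrite (_ : x - y = (x - c) - (y - c)); last by rewrite opprB addrA subrK.
apply: le_trans (ler_normB _ _) _; rewrite mulr2n mulrDl mul1r.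
exact: lerD.
Qed.

(** * Lebesgue outer measure *)

Definition box_volume (R : realType) (k : nat) (a b : 'rV[R]_k) : \bar R :=
  (\prod_(j < k) (b 0 j - a 0 j))%:E.

Lemma box_volume_ge0 (R : realType) k (a b : 'rV[R]_k) :
  (forall j, a 0 j <= b 0 j) -> (0 <= box_volume a b)%E.
Proof. by move=> ab; rewrite lee_fin prodr_ge0// => j _; rewrite subr_ge0. Qed.

Lemma le_lebesgue_outer (R : realType) k (A B : set 'rV[R]_k) :
  A `<=` B -> (lebesgue_outer A <= lebesgue_outer B)%E.
Proof.
move=> AB; apply: le_ereal_inf => _ [ab [ab0 Bab] <-].
by exists ab => //; split => //; exact: subset_trans Bab.
Qed.

(** Cover [A i] by boxes of total volume at most [e / 2 ^ i.+1] and merge the covers along a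
    bijection of [nat] with [nat * nat]. *)
Lemma lebesgue_outer_bigcup_null (R : realType) k (A : nat -> set 'rV[R]_k) :
  (forall i, (lebesgue_outer (A i) <= 0)%E) ->
  (lebesgue_outer (\bigcup_i A i) <= 0)%E.
Proof.
move=> A0; apply/lee_addgt0Pr => e e0; rewrite add0e.
pose P i (ab : (nat -> 'rV[R]_k) * (nat -> 'rV[R]_k)) :=
  [/\ forall m j, ab.1 m 0 j <= ab.2 m 0 j,
      A i `<=` \bigcup_m box (ab.1 m) (ab.2 m) &
      (\sum_(0 <= m <oo) box_volume (ab.1 m) (ab.2 m) <=
        (e / (2 ^ i.+1)%:R)%:E)%E].
have [G PG] : {G & forall i, P i (G i)}.
  apply: choice => i.
  have : (lebesgue_outer (A i) < (e / (2 ^ i.+1)%:R)%:E)%E.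
    by apply: le_lt_trans (A0 i) _; rewrite lte_fin divr_gt0.
  by move=> /ereal_inf_lt[_ [ab [ab0 Aab] <-] /ltW abe]; exists ab; split.
have /card_esym/ppcard_eqP[f] := card_nat2.
pose v (im : nat * nat) := box_volume ((G im.1).1 im.2) ((G im.1).2 im.2).
have v0 im : (0 <= v im)%E.
  by apply: box_volume_ge0 => j; have [+ _ _] := PG im.1; apply.
apply: (@le_trans _ _ (\esum_(im in setT) v im)).
  apply: ereal_inf_lbound => /=.
  exists (fun l => (G (f l).1).1 (f l).2, fun l => (G (f l).1).2 (f l).2).
    split => /= [l j|x [i _ Aix]]; first by have [+ _ _] := PG (f l).1; apply.
    have [_ /(_ x Aix)[m _ xm] _] := PG i.
    by exists (f^-1%FUN (i, m)) => //=; rewrite invK ?inE.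
  rewrite [LHS]nneseries_esumT; last by move=> l; exact: (v0 (f l)).
  by rewrite (reindex_esum setT setT f).
have -> : \esum_(im in [set: nat * nat]) v im =
          (\sum_(0 <= i <oo) \sum_(0 <= m <oo) v (i, m))%E.
  rewrite nneseries_esumT; last by move=> i; exact: nneseries_ge0.
  rewrite [RHS](eq_esum (fun i _ => nneseries_esumT (fun m => v0 (i, m)))).
  rewrite esum_esum//; congr esum.
  by apply/seteqP; split.
apply: le_trans (epsilon_trick0 xpredT (ltW e0)).
apply: lee_nneseries => [i _ _|i _]; first exact: nneseries_ge0.
by have [_ _] := PG i.
Qed.

Lemma lebesgue_outer_cubes (R : realType) k (S : set 'rV[R]_k) T
    (s : 'I_T -> 'rV[R]_k) (d : R) :
  (0 < k)%N -> 0 <= d -> (forall x, S x -> exists i, `|x - s i| <= d) ->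
  (lebesgue_outer S <= (T%:R * (2 * d) ^+ k)%:E)%E.
Proof.
move=> k0 d0 Sd.
(* The cubes have opposite corners [a i (- d)] and [a i d]. From index [T] on, both corners are 0;
   as [0 < k], such a box has volume 0 and not the value 1 of an empty product. *)
pose a i (D : R) : 'rV[R]_k :=
  if insub i is Some i' then \row_j (s i' 0 j + D) else 0.
have aE (i : 'I_T) D j : a i D 0 j = s i 0 j + D by rewrite /a valK mxE.
have aT i D : (T <= i)%N -> a i D = 0.
  by rewrite /a leqNgt => iT; rewrite insubF//; apply: negbTE.
have ale i j : a i (- d) 0 j <= a i d 0 j.
  rewrite /a; case: insubP => [i' _ _|_]; rewrite ?mxE//.
  by lra.
have -> : (T%:R * (2 * d) ^+ k)%:E =
  (\sum_(0 <= i <oo) box_volume (a i (- d)%R) (a i d))%E.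
  rewrite (nneseries_split 0%N T); last first.
    by move=> i _; apply: box_volume_ge0 => j.
  rewrite add0n eseries0 ?adde0; last first.
    move=> i Ti _; rewrite /box_volume !aT//; congr EFin.
    by rewrite (bigD1 (Ordinal k0))//= subrr mul0r.
  rewrite big_mkord (eq_bigr (fun=> ((2 * d) ^+ k)%:E)); last first.
    move=> i _; rewrite /box_volume; congr EFin.
    rewrite (eq_bigr (fun=> 2 * d)) ?prodr_const ?card_ord// => j _.
    by rewrite !aE; ring.
  by rewrite sumEFin sumr_const card_ord mulr_natl.
apply: ereal_inf_lbound.
exists (fun i => a i (- d), fun i => a i d) => //; split => //= x.
move=> /Sd[i xi]; exists i => // j; rewrite !aE.
have /le_trans/(_ xi) := ge_entry_rV_norm (x - s i) j.
by rewrite !mxE ler_norml => /andP[? ?]; lra.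
Qed.

(** * Separated families, covering numbers and upper box dimension *)

(** A separated family with the largest number of members is a net: a point close to no member could
    be appended to it. *)
Lemma maximal_separated (T : Type) (close : T -> T -> Prop) (A : set T) N :
  (forall x y, close x y -> close y x) ->
  (forall m (f : 'I_m -> T), (forall i, A (f i)) ->
    (forall i j, i != j -> ~ close (f i) (f j)) -> (m <= N)%N) ->
  exists m (f : 'I_m -> T),
    [/\ forall i, A (f i), forall i j, i != j -> ~ close (f i) (f j) &
        forall x, A x -> exists i, close x (f i)].
Proof.
move=> closeC AN.
pose sep m (f : 'I_m -> T) :=
  (forall i, A (f i)) /\ (forall i j, i != j -> ~ close (f i) (f j)).
have ex0 : exists m, `[< exists f, @sep m f >].
  exists 0%N; apply/asboolP.
  have f0 : 'I_0 -> T by case.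
  by exists f0; split => -[].
have leN m : `[< exists f, @sep m f >] -> (m <= N)%N.
  by move=> /asboolP[f [Af fsep]]; exact: AN Af fsep.
case: (ex_maxnP ex0 leN) => m /asboolP[f [Af fsep]] mmax.
exists m, f; split => // x Ax; apply: contrapT => xf.
suff /mmax : `[< exists g, @sep m.+1 g >] by rewrite ltnn.
apply/asboolP.
exists (fun i => if unlift ord_max i is Some j then f j else x).
split => [i|i j]; first by case: unliftP.
case: unliftP => [i' ->|->]; case: unliftP => [j' ->|->] ij.
- by apply: fsep; apply: contraNneq ij => ->.
- by move=> /closeC ?; apply: xf; exists i'.
- by move=> ?; apply: xf; exists j'.
- by rewrite eqxx in ij.
Qed.

Lemma covering_number_ge0 (R : realType) n (A : set 'rV[R]_n) r :
  (0 <= covering_number A r)%E.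
Proof. by apply: le_ereal_inf_tmp => _ [m _ <-]; rewrite lee_fin. Qed.

Lemma covering_number_le (R : realType) n (A : set 'rV[R]_n) r m
    (c : 'I_m -> 'rV[R]_n) :
  (forall x, A x -> exists i, eball (c i) r x) ->
  (covering_number A r <= m%:R%:E)%E.
Proof.
move=> Ac; apply: ereal_inf_lbound; exists m => //; exists c => x /Ac[i xi].
by exists i.
Qed.

(** The infimum runs over natural numbers: being below [(Num.trunc x).+1], it leaves room for some
    [m <= Num.trunc x]. *)
Lemma covering_number_le_ex (R : realType) n (A : set 'rV[R]_n) r (x : R) :
  (covering_number A r <= x%:E)%E ->
  exists m (c : 'I_m -> 'rV[R]_n),
    m%:R <= x /\ forall y, A y -> exists i, eball (c i) r y.
Proof.
move=> Ax.
have x0 : 0 <= x by rewrite -lee_fin (le_trans _ Ax)// covering_number_ge0.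
have : (covering_number A r < (Num.trunc x).+1%:R%:E)%E.
  by apply: le_lt_trans Ax _; rewrite lte_fin; case/andP: (truncn_itv x0).
move=> /ereal_inf_lt[_ [m [c Ac] <-]]; rewrite lte_fin ltr_nat ltnS => mx.
exists m, c; split => [|y /Ac[i _ yi]]; last by exists i.
by apply: le_trans (_ : (Num.trunc x)%:R <= x); rewrite ?ler_nat// truncn_le.
Qed.

(** Since [ln r^-1] is positive, clear the denominator and exponentiate. The values 0 and [+oo] of
    [x] are included, because [lne] is increasing on all of [0, [+oo]]. *)
Lemma log_ratio_le (R : realType) (x : \bar R) (r s : R) :
  (0 <= x)%E -> 0 < r < 1 ->
  (lne x * ((ln r^-1)^-1)%:E <= s%:E)%E = (x <= (r `^ (- s))%:E)%E.
Proof.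
move=> x0 /andP[r0 r1]; have L0 : 0 < ln r^-1.
  by apply: ln_gt0; rewrite invf_gt1.
rewrite lee_pdivrMr// -lee_lne; last 2 first.
- by rewrite in_itv/= x0 leey.
- by rewrite in_itv/= leey lee_fin powR_ge0.
by rewrite lne_EFin ?powR_gt0// ln_powR lnV ?posrE// -EFinM mulNr mulrN.
Qed.

Lemma near_at_right0_lt1 (R : realType) : \forall r \near (0 : R)^'+, 0 < r < 1.
Proof.
near=> r; apply/andP; split; near: r; first exact: nbhs_right_gt.
exact: nbhs_right_lt.
Unshelve. all: by end_near. Qed.

Lemma upper_box_dim_lt (R : realType) n (A : set 'rV[R]_n) (s : R) :
  (upper_box_dim A < s%:E)%E ->
  \forall r \near 0^'+, (covering_number A r <= (r `^ (- s))%:E)%E.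
Proof.
move=> /ereal_inf_lt[_ [V V0 <-] Vs].
near=> r; rewrite -log_ratio_le ?covering_number_ge0//; last first.
  by near: r; exact: near_at_right0_lt1.
apply: le_trans (ltW Vs); apply: ereal_sup_ubound; exists r => //.
by near: r.
Unshelve. all: by end_near. Qed.

Lemma near_at_right0_powR (R : realType) (C e : R) : 0 < e ->
  \forall r \near (0 : R)^'+, C <= r `^ (- e).
Proof.
move=> e0; have C1 : 0 < `|C| + 1 by rewrite ltr_pwDr.
near=> r.
have r0 : 0 < r by near: r; exact: nbhs_right_gt.
apply: (@le_trans _ _ (`|C| + 1)).
  by apply: le_trans (ler_norm _) _; rewrite lerDl.
rewrite -ler_ln ?posrE ?powR_gt0// ln_powR mulNr -mulrN -ler_pdivrMl//.
rewrite lerNr -[leRHS]expRK ler_ln ?posrE ?expR_gt0//.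
by near: r; apply: nbhs_right_le; exact: expR_gt0.
Unshelve. all: by end_near. Qed.

(** For every [e > 0] the constant [C] is at most [r ^ (- e)] once [r] is small, so it only costs
    [e] in the exponent. *)
Lemma upper_box_dim_le (R : realType) n (A : set 'rV[R]_n) (t C : R) :
  (\forall r \near 0^'+, (covering_number A r <= (C * r `^ (- t))%:E)%E) ->
  (upper_box_dim A <= t%:E)%E.
Proof.
move=> AC; apply/lee_addgt0Pr => e e0; rewrite -EFinD.
pose V := [set r : R | 0 < r < 1 /\
  (covering_number A r <= (r `^ (- (t + e)))%:E)%E].
apply: (@le_trans _ _ (ereal_sup ((fun r : R =>
    (lne (covering_number A r) * ((ln r^-1)^-1)%:E)%E) @` V))).
  apply: ereal_inf_lbound; exists V => //.
  near=> r; have r01 : 0 < r < 1 by near: r; exact: near_at_right0_lt1.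
  have /andP[r0 _] := r01; split => //.
  apply: (@le_trans _ _ (C * r `^ (- t))%:E); first by near: r.
  rewrite lee_fin opprD addrC powRD; last by rewrite (gt_eqF r0) implybT.
  rewrite ler_wpM2r ?powR_ge0//.
  by near: r; exact: near_at_right0_powR.
apply: ge_ereal_sup => _ [r [r01 Ar] <-].
by rewrite log_ratio_le ?covering_number_ge0.
Unshelve. all: by end_near. Qed.

(** * Dilation ratios and collisions *)

Definition ratio (R : realType) M (i : 'I_M) : R := 1 + i%:R / M%:R.

Lemma ratio_bounds (R : realType) M (i : 'I_M) : 1 <= ratio R i <= 2.
Proof.
have M0 : 0 < M%:R :> R by rewrite ltr0n (leq_ltn_trans _ (ltn_ord i)).
rewrite /ratio lerDl divr_ge0//= (_ : 2 = 1 + 1)// lerD2l ler_pdivrMr// mul1r.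
by rewrite ler_nat ltnW.
Qed.

Lemma ratio_dist (R : realType) M (i j : 'I_M) : i != j ->
  1 <= M%:R * `|ratio R i - ratio R j|.
Proof.
move=> ij; have M0 : 0 < M%:R :> R.
  by rewrite ltr0n (leq_ltn_trans _ (ltn_ord i)).
rewrite /ratio (_ : _ - _ = (i%:R - j%:R) / M%:R); last by ring.
rewrite normrM normfV (ger0_norm (ltW M0)) mulrC divfK ?gt_eqF//.
have := ij; rewrite -val_eqE neq_ltn => /orP[|] lij.
  rewrite distrC ger0_norm ?subr_ge0 ?ler_nat ?(ltnW lij)// lerBrDl.
  by rewrite natr1 ler_nat.
rewrite ger0_norm ?subr_ge0 ?ler_nat ?(ltnW lij)// lerBrDl.
by rewrite natr1 ler_nat.
Qed.

(** Only the indices of ratios and balls are recorded, not the points [y] and [z], so that all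
    collisions lie in one finite set of size [(M * N) ^ 2], the same for every [x]. *)
Definition collisions (R : realType) n M N (q : 'I_N -> 'rV[R]_n) (r d : R)
    (x : 'rV[R]_n) : {set ('I_M * 'I_N) * ('I_M * 'I_N)} :=
  [set w | (w.1.1 != w.2.1) && `[< exists y z,
    [/\ eball (q w.1.2) r y, eball (q w.2.2) r z &
        `|ratio R w.1.1 *: (y - x) - ratio R w.2.1 *: (z - x)| <= d] >]].

(** Subtracting the two approximate equations isolates [x - x'] with coefficient
    [ratio R i - ratio R j], of absolute value at least [1 / M]. The two errors contribute [2 * d];
    the displacements inside the two balls, dilated by at most 2, contribute [4 * r] each. *)
Lemma collisions_close (R : realType) n M N (q : 'I_N -> 'rV[R]_n) (r d : R)
    (x x' : 'rV[R]_n) w :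
  w \in @collisions R n M N q r d x -> w \in collisions M q r d x' ->
  `|x - x'| <= M%:R * (2 * d + 8 * r).
Proof.
case: w => -[i a] [j b]; rewrite !inE /=.
move=> /andP[ij /asboolP[y [z [ya zb xd]]]].
move=> /andP[_ /asboolP[y' [z' [ya' zb' xd']]]].
have yy := eball_norm ya ya'; have zz := eball_norm zb zb'.
have /andP[i1 i2] := ratio_bounds R i; have /andP[j1 j2] := ratio_bounds R j.
have r0 : 0 <= r by apply: le_trans (enorm_ge0 _) ya.
have xx : `|(ratio R i - ratio R j) *: (x - x')| <= 2 * d + 8 * r.
  have -> : (ratio R i - ratio R j) *: (x - x') =
      ratio R i *: (y - y') - ratio R j *: (z - z')
      - ((ratio R i *: (y - x) - ratio R j *: (z - x)) -
         (ratio R i *: (y' - x') - ratio R j *: (z' - x'))).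
    by apply/rowP => l; rewrite !mxE; ring.
  apply: le_trans (ler_normB _ _) _.
  have := ler_normB (ratio R i *: (y - x) - ratio R j *: (z - x))
    (ratio R i *: (y' - x') - ratio R j *: (z' - x')).
  have := ler_normB (ratio R i *: (y - y')) (ratio R j *: (z - z')).
  rewrite !(mx_normZ _ (_ - _)) !ger0_norm ?(le_trans ler01)//.
  have : ratio R i * `|y - y'| <= 2 * (2 * r) by apply: ler_pM => //; lra.
  have : ratio R j * `|z - z'| <= 2 * (2 * r) by apply: ler_pM => //; lra.
  lra.
have := ratio_dist R ij.
move: xx; rewrite mx_normZ => xx ij1.
apply: le_trans (ler_wpM2l _ xx) => //.
by rewrite mulrA ler_peMl.
Qed.

(** Double counting: by [collisions_close] and separation, each index tuple is a collision of at
    most one [x a]. *)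
Lemma sum_collisions (R : realType) n M N (q : 'I_N -> 'rV[R]_n) (r d D : R)
    X (x : 'I_X -> 'rV[R]_n) :
  (forall a b, a != b -> ~ `|x a - x b| <= M%:R * (2 * d + 8 * r)) ->
  (forall a, D <= #|collisions M q r d (x a)|%:R) ->
  X%:R * D <= ((M * N) ^ 2)%:R.
Proof.
move=> xsep xD.
have -> : X%:R * D = \sum_(a < X) D by rewrite sumr_const card_ord mulr_natl.
apply: le_trans (ler_sum _ (fun a _ => xD a)) _.
rewrite -natr_sum ler_nat.
under eq_bigr do rewrite -sum1_card big_mkcond/=.
rewrite exchange_big/=.
apply: (@leq_trans (\sum_(w : ('I_M * 'I_N) * ('I_M * 'I_N)) 1)%N); last first.
  by rewrite sum1_card !card_prod !card_ord.
apply: leq_sum => w _; rewrite -big_mkcond sum1dep_card.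
apply/card_le1_eqP => a b.
rewrite finset.in_set => wa; rewrite finset.in_set => wb.
case: (eqVneq a b) => // ab.
by have := xsep _ _ ab (collisions_close wa wb).
Qed.

(** * Separated points on a plane and their collisions *)

Lemma affine_paramB (R : realType) n k (p : 'rV[R]_n) (V : 'M[R]_(k, n)) t t' :
  affine_param p V t - affine_param p V t' = (t - t') *m V.
Proof. by rewrite /affine_param mulmxBl opprD addrACA subrr add0r. Qed.

(** Two points in a common ball are at sup distance at most [2 * r]; passing to parameters costs a
    factor [n], so separated parameters need different balls. *)
Lemma separated_ball_choice (R : realType) n k N (q : 'I_N -> 'rV[R]_n) (r : R)
    (B : set 'rV[R]_n) (p : 'rV[R]_n) (V : 'M[R]_(k, n)) T
    (s : 'I_T -> 'rV[R]_k) :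
  V *m V^T = 1%:M ->
  (forall y, B y -> exists a, eball (q a) r y) ->
  (forall t, B (affine_param p V (s t))) ->
  (forall t t', t != t' -> ~ `|s t - s t'| <= n%:R * (2 * r)) ->
  exists2 b : 'I_T -> 'I_N, injective b &
    forall t, eball (q (b t)) r (affine_param p V (s t)).
Proof.
move=> VV Bq Bs ssep; have [b bq] := choice (fun t => Bq _ (Bs t)).
exists b => // t t' bt; case: (eqVneq t t') => // /ssep[].
apply: le_trans (norm_le_mul_orthonormal _ VV) _; rewrite ler_wpM2l//.
by rewrite -(affine_paramB p); apply: eball_norm (bq t) _; rewrite bt.
Qed.

(** Separated families have at most [N] members, so a maximal one exists. Cubes around its members
    cover the preimage of [B], which turns a lower bound on measure into a lower bound on [T] of
    order [r ^ (- k)]. *)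
Lemma exists_separated (R : realType) n k N (q : 'I_N -> 'rV[R]_n) (r : R)
    (B : set 'rV[R]_n) (p : 'rV[R]_n) (V : 'M[R]_(k, n)) :
  (0 < k)%N -> 0 <= r -> V *m V^T = 1%:M ->
  (forall y, B y -> exists a, eball (q a) r y) ->
  exists T (s : 'I_T -> 'rV[R]_k) (b : 'I_T -> 'I_N),
    [/\ injective b,
        forall t, B (affine_param p V (s t)) /\
                  eball (q (b t)) r (affine_param p V (s t)),
        forall t t', t != t' -> ~ `|s t - s t'| <= n%:R * (2 * r) &
        (lebesgue_outer (affine_param p V @^-1` B) <=
          (T%:R * (2 * (n%:R * (2 * r))) ^+ k)%:E)%E].
Proof.
move=> k0 r0 VV Bq.
have [||T [s [Bs ssep smax]]] := @maximal_separated _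
  (fun s s' : 'rV[R]_k => `|s - s'| <= n%:R * (2 * r))
  (affine_param p V @^-1` B) N.
- by move=> s s'; rewrite distrC.
- move=> T s Bs ssep; have [b b_inj _] := separated_ball_choice VV Bq Bs ssep.
  by have := leq_card b b_inj; rewrite !card_ord.
have [b b_inj bq] := separated_ball_choice VV Bq Bs ssep.
have d0 : 0 <= n%:R * (2 * r) by rewrite !mulr_ge0.
exists T, s, b; split => //; last exact: lebesgue_outer_cubes k0 d0 smax.
by move=> t; split; [exact: Bs|exact: bq].
Qed.

Lemma trunc_eq_dist (R : realType) (x y : R) :
  0 <= x -> 0 <= y -> Num.trunc x = Num.trunc y -> `|x - y| <= 1.
Proof.
move=> /truncn_itv/andP[x1 x2] /truncn_itv/andP[y1 y2] xy.
move: x1 x2 y1 y2; rewrite xy -natr1 ler_norml => *; lra.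
Qed.

(** Pigeonhole: the [M * T] dilated parameters lie in a cube that is cut into [L.+1 ^ k] cells.
    Apart from one representative per cell, each of them collides with the representative of its
    cell. *)
Lemma card_collisions (R : realType) n k M N T L (q : 'I_N -> 'rV[R]_n)
    (r rho : R) (p : 'rV[R]_n) (V : 'M[R]_(k, n)) (u : 'rV[R]_k)
    (s : 'I_T -> 'rV[R]_k) (b : 'I_T -> 'I_N) :
  (0 < n)%N -> 0 < r -> V *m V^T = 1%:M -> injective b ->
  (forall t, eball (q (b t)) r (affine_param p V (s t))) ->
  (forall t t', t != t' -> ~ `|s t - s t'| <= n%:R * (2 * r)) ->
  (forall t, `|affine_param p V (s t) - affine_param p V u| <= 2 * rho) ->
  4 * rho / r <= L%:R ->
  (M * T <= L.+1 ^ k +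
    #|collisions M q r (k%:R * (n%:R * (2 * r))) (affine_param p V u)|)%N.
Proof.
move=> n0 r0 VV b_inj bq ssep su rhoL.
have n0' : 0 < n%:R :> R by rewrite ltr0n.
set d := n%:R * (2 * r).
have d0 : 0 < d by rewrite !mulr_gt0.
pose v (a : 'I_M * 'I_T) : 'rV[R]_k := ratio R a.1 *: (s a.2 - u).
pose H := 4 * n%:R * rho.
have vH a j : - H <= v a 0 j <= H.
  rewrite -ler_norml; apply: le_trans (ge_entry_rV_norm _ _) _.
  have /andP[l1 l2] := ratio_bounds R a.1.
  rewrite /v mx_normZ ger0_norm ?(le_trans ler01)//.
  have -> : H = 2 * (n%:R * (2 * rho)) by rewrite /H; ring.
  apply: ler_pM => //; first exact: le_trans l1.
  apply: le_trans (norm_le_mul_orthonormal _ VV) _.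
  by rewrite ler_wpM2l// -(affine_paramB p).
pose y a j := (v a 0 j + H) / d.
have y0 a j : 0 <= y a j.
  by rewrite divr_ge0 ?(ltW d0)//; have /andP[] := vH a j; lra.
(* The side [2 * H] of the large cube is [4 * rho / r] cells long; [L.+1] rather than [L] because
   the upper end is included. *)
have yL a j : (Num.trunc (y a j) < L.+1)%N.
  rewrite truncn_lt_nat//; apply: (@le_lt_trans _ _ L%:R); last first.
    by rewrite ltr_nat.
  apply: le_trans rhoL; rewrite ler_pdivrMr//.
  have -> : 4 * rho / r * d = H + H.
    by rewrite /d /H; field; rewrite gt_eqF.
  by rewrite lerD2r; have /andP[] := vH a j.
(* A cell contains at most one point of each dilate, so [cell] is far from
   injective as soon as [M * T] exceeds the number of cells. *)
pose cell a : {ffun 'I_k -> 'I_L.+1} := [ffun j => Ordinal (yL a j)].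
have cell_close a a' : cell a = cell a' -> `|v a - v a'| <= d.
  move=> aa'; apply: rV_norm_le => [|j]; first exact: ltW.
  rewrite mxE [X in _ + X]mxE.
  have : `|y a j - y a' j| <= 1.
    apply: trunc_eq_dist => //.
    by move/ffunP : aa' => /(_ j); rewrite !ffunE => /(congr1 val).
  rewrite (_ : y a j - y a' j = (v a 0 j - v a' 0 j) / d); last first.
    by rewrite /y; field; rewrite gt_eqF.
  by rewrite normrM normfV (gtr0_norm d0) ler_pdivrMr// mul1r.
(* The representative depends on the cell alone, so [cell] is injective on the representatives,
   which form the complement of [D]. *)
pose first_in a := [pick a' | cell a' == cell a].
pose D := [set a | first_in a != Some a]%SET.
have -> : (M * T = #|~: D| + #|D|)%N.
  by rewrite addnC cardsC card_prod !card_ord.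
apply: leq_add.
  rewrite -(card_in_imset (f := cell)).
    by apply: leq_trans (max_card _) _; rewrite card_ffun !card_ord.
  move=> a a'; rewrite !finset.inE !negbK /first_in => /eqP fa /eqP fa' aa'.
  by move: fa; rewrite aa' fa' => -[].
(* The default is never reached, as [a] lies in its own cell. The first component of [g a] already
   determines [a], since [b] is injective. *)
pose g a := let a' := odflt a (first_in a) in ((a.1, b a.2), (a'.1, b a'.2)).
rewrite -(card_imset (f := g)); last first.
  by move=> [i t] [j t'] [-> /b_inj ->].
apply: subset_leq_card; apply/fintype.subsetP => _ /imsetP[a aD ->].
move: aD; rewrite !finset.inE /g /first_in.
case: pickP => [a' /eqP aa'|]; last first.
  by move=> /(_ a); rewrite eqxx.
move=> /= a'a; have {}a'a : a != a' by apply: contraNneq a'a => ->.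
apply/andP; split.
  (* With equal ratios, at least 1, the original parameters would be as close as the dilated ones,
     against their separation. *)
  apply: contra_neq (a'a); case: a a' aa' {a'a} => [i t] [j t'] /= aa' ij.
  subst j; have [->//|/ssep[]] := eqVneq t t'.
  have := cell_close _ _ (esym aa'); rewrite /v /= -scalerBr opprB addrA subrK.
  have /andP[l1 _] := ratio_bounds R i.
  rewrite mx_normZ ger0_norm ?(le_trans ler01)//; apply: le_trans.
  by rewrite ler_peMl.
apply/asboolP; exists (affine_param p V (s a.2)), (affine_param p V (s a'.2)).
split; [exact: bq|exact: bq|].
rewrite !affine_paramB !scalemxAl -mulmxBl.
apply: le_trans (norm_mul_orthonormal_le _ VV) _; rewrite ler_wpM2l//.
exact: cell_close.
Qed.

(** * Points on planes that meet a bounded set in substantial measure *)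

(** Fixing the lower bound [c] and the radius [rho] lets a single number [M] of dilates serve all
    points of the piece. *)
Definition piece (R : realType) n k (B : set 'rV[R]_n) (c rho : R) :
    set 'rV[R]_n :=
  [set x | `|x| <= rho /\ exists p (V : 'M[R]_(k, n)),
    [/\ V *m V^T = 1%:M, range (affine_param p V) x &
        (c%:E <= lebesgue_outer (affine_param p V @^-1` B))%E]].

Lemma covering_number_piece (R : realType) n k (B : set 'rV[R]_n) (c rho : R) :
  (0 < k <= n)%N -> 0 < c -> 1 <= rho -> (forall y, B y -> `|y| <= rho) ->
  exists A C : R, 0 < A /\
    forall r N (q : 'I_N -> 'rV[R]_n), 0 < r <= 1 ->
      (forall y, B y -> exists a, eball (q a) r y) ->
      (covering_number (piece k B c rho) (A * r) <=
        (C * N%:R ^+ 2 * r ^+ k)%:E)%E.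
Proof.
move=> /andP[k0 kn] c0 rho1 Brho; have n0 := leq_trans k0 kn.
have rho0 : 0 < rho by apply: lt_le_trans rho1.
(* After multiplication by [r ^+ k], the number of dilated points is at least [M * c / (4 * n) ^ k]
   and the number of cells at most [(6 * rho) ^ k]. This choice makes the difference at least 1. *)
pose z := ((6 * rho) ^+ k + 1) * (4 * n%:R) ^+ k / c.
have z0 : 0 <= z.
  rewrite divr_ge0 ?(ltW c0)// mulr_ge0 ?addr_ge0 ?exprn_ge0// ?mulr_ge0//.
  exact: ltW.
pose M := (Num.trunc z).+1.
have zM : z <= M%:R by apply/ltW; have /andP[] := truncn_itv z0.
(* The first witness is [n * K / r] for the separation [K] below; the factor [n] converts sup balls
   into Euclidean ones. *)
exists (n%:R * (M%:R * (2 * (k%:R * (n%:R * 2)) + 8))), (M%:R ^+ 2).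
split=> [|r N q /andP[r0 r1] Bq].
  by rewrite !mulr_gt0 ?ltr0n// ltr_wpDl// !mulr_ge0.
have rk0 : 0 < r ^+ k by rewrite exprn_gt0.
set d := k%:R * (n%:R * (2 * r)).
pose K := M%:R * (2 * d + 8 * r).
have manyG x : piece k B c rho x -> (r ^+ k)^-1 <= #|collisions M q r d x|%:R.
  move=> [xrho [p [V [VV [u _ ux] cB]]]]; subst x.
  have [T [s [b [b_inj bq ssep BT]]]] :=
    @exists_separated _ _ _ _ q r B p V k0 (ltW r0) VV Bq.
  have {BT cB} := le_trans cB BT; rewrite lee_fin => cT.
  pose L := (Num.trunc (4 * rho / r)).+1.
  have rho_r : 1 <= rho / r by rewrite ler_pdivlMr// mul1r (le_trans r1).
  have /andP[L1 L2] : (Num.trunc (4 * rho / r))%:R <= 4 * rho / r < L%:R.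
    by apply: truncn_itv; rewrite -mulrA mulr_ge0// (le_trans ler01).
  (* Here [L.+1] is at most [4 * rho / r + 2], and 2 is absorbed because [1 <= rho / r]. *)
  have LL : L.+1%:R * r <= 6 * rho.
    rewrite -ler_pdivlMr// -natr1 /L -natr1; move: L1 rho_r.
    by rewrite -!mulrA => ? ?; lra.
  have su t : `|affine_param p V (s t) - affine_param p V u| <= 2 * rho.
    apply: le_trans (ler_normB _ _) _; rewrite mulr2n mulrDl mul1r.
    by apply: lerD => //; apply: Brho; case: (bq t).
  have := @card_collisions _ _ _ M N T L q r rho p V u s b n0 r0 VV b_inj
    (fun t => (bq t).2) ssep su (ltW L2).
  rewrite -(ler_nat R) natrD natrM natrX -/d.
  set G := #|_|%:R => MTG.
  rewrite -[_^-1]mul1r ler_pdivrMr//.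
  have H1 : (L.+1%:R ^+ k) * r ^+ k <= (6 * rho) ^+ k :> R.
    by rewrite -exprMn lerXn2r// nnegrE mulr_ge0 ?(ltW r0)// ltW.
  have H2 : (6 * rho) ^+ k + 1 <= M%:R * T%:R * r ^+ k.
    have n4 : 0 < (4 * n%:R) ^+ k :> R by rewrite exprn_gt0// mulr_gt0// ltr0n.
    rewrite -(ler_pM2r n4) -[leLHS](divfK (lt0r_neq0 c0)).
    apply: le_trans (ler_wpM2r (ltW c0) zM) _.
    rewrite (_ : _ * _ * _ * _ = M%:R * (T%:R * (2 * (n%:R * (2 * r))) ^+ k)).
      by rewrite ler_wpM2l.
    rewrite (_ : 2 * (n%:R * (2 * r)) = r * (4 * n%:R)); last by ring.
    by rewrite (exprMn k r); ring.
  have := ler_wpM2r (ltW rk0) MTG; rewrite mulrDl; lra.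
have sepX X (x : 'I_X -> 'rV[R]_n) : (forall a, piece k B c rho (x a)) ->
    (forall a b, a != b -> ~ `|x a - x b| <= K) ->
    X%:R <= M%:R ^+ 2 * N%:R ^+ 2 * r ^+ k.
  move=> xB xK; have := sum_collisions xK (fun a => manyG _ (xB a)).
  by rewrite ler_pdivrMr// natrX natrM exprMn.
have C0 : 0 <= M%:R ^+ 2 * N%:R ^+ 2 * r ^+ k :> R.
  by rewrite !mulr_ge0 ?exprn_ge0// ltW.
have [||X [x [xB xK Xmax]]] := @maximal_separated _
  (fun x y : 'rV[R]_n => `|x - y| <= K) (piece k B c rho)
  (Num.trunc (M%:R ^+ 2 * N%:R ^+ 2 * r ^+ k : R)).
- by move=> x y; rewrite distrC.
- by move=> X x xB xK; rewrite truncn_ge_nat//; exact: sepX xB xK.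
apply: (@le_trans _ _ X%:R%:E); last by rewrite lee_fin; exact: sepX xB xK.
apply: (@covering_number_le _ _ _ _ _ x) => y /Xmax[a ya]; exists a.
apply: le_trans (enorm_le_norm _) _.
rewrite -mulrA ler_wpM2l//; apply: le_trans ya _.
by rewrite /K /d -mulrA ler_wpM2l//; lra.
Qed.

Lemma near_at_right0_div (R : realType) (P : set R) (A : R) : 0 < A ->
  (\forall r \near 0^'+, P r) -> \forall r \near 0^'+, P (r / A).
Proof.
move=> A0 [e /= e0 eP]; exists (e * A); first by rewrite /= mulr_gt0.
move=> r /= rA r0; apply: eP => /=; last by rewrite divr_gt0.
move: rA; rewrite !sub0r !normrN => rA.
by rewrite normrM normfV (gtr0_norm A0) ltr_pdivrMr.
Qed.

(** To cover the piece at scale [r], cover [B] at scale [r / A] by [N <= (r / A) ^ (- s)] balls;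
    then [N ^ 2 * (r / A) ^ k] has exponent [- (2 * s - k)]. *)
Lemma upper_box_dim_piece (R : realType) n k (B : set 'rV[R]_n) (c rho s : R) :
  (0 < k <= n)%N -> 0 < c -> 1 <= rho -> (forall y, B y -> `|y| <= rho) ->
  (upper_box_dim B < s%:E)%E ->
  (upper_box_dim (piece k B c rho) <= (2 * s - k%:R)%:E)%E.
Proof.
move=> kn c0 rho1 Brho /upper_box_dim_lt Bs.
have [A [C [A0 AC]]] := covering_number_piece kn c0 rho1 Brho.
apply: (@upper_box_dim_le _ _ _ _ (`|C| * A^-1 `^ (- (2 * s - k%:R)))).
have := near_at_right0_div A0 Bs.
have := near_at_right0_div A0 (near_at_right0_lt1 R).
apply: filterS2 => r /andP[rA0 rA1] /covering_number_le_ex[N [q [Ns Bq]]].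
have r0 : 0 < r by move: rA0; rewrite pmulr_lgt0// invr_gt0.
rewrite -{1}(divfK (lt0r_neq0 A0) r) [r / A * A]mulrC.
apply: le_trans (AC _ N q _ Bq) _; first by rewrite rA0 ltW.
rewrite lee_fin -[leLHS]mulrA -[leRHS]mulrA.
apply: le_trans (ler_wpM2r _ (ler_norm C)) _.
  by rewrite mulr_ge0 ?exprn_ge0// ltW.
rewrite ler_wpM2l// [leRHS]mulrC -powRM ?(ltW r0) ?invr_ge0 ?(ltW A0)//.
have -> : - (2 * s - k%:R) = - s * 2%:R + k%:R by ring.
rewrite powRD ?(gt_eqF rA0) ?implybT// powRrM powR_mulrn ?powR_ge0//.
rewrite powR_mulrn ?(ltW rA0)// ler_wpM2r ?exprn_ge0 ?(ltW rA0)//.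
by rewrite lerXn2r ?nnegrE ?powR_ge0.
Qed.

Lemma exists_pos_le (R : realType) (x : \bar R) :
  (0 < x)%E -> exists2 c : R, 0 < c & (c%:E <= x)%E.
Proof.
case: x => [c||//]; last by exists 1; rewrite ?leey.
by rewrite lte_fin => c0; exists c.
Qed.

(** If [s < k], then [c <= T * (4 * n * r) ^ k] with [T <= N <= r ^ (- s)] bounds [c] by a constant
    times [r ^ (k - s)], which fails for one small [r]. *)
Lemma upper_box_dim_ge (R : realType) n k (B : set 'rV[R]_n) (s : R)
    (p : 'rV[R]_n) (V : 'M[R]_(k, n)) :
  (0 < k <= n)%N -> V *m V^T = 1%:M ->
  (0 < lebesgue_outer (affine_param p V @^-1` B))%E ->
  (upper_box_dim B < s%:E)%E -> k%:R <= s.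
Proof.
move=> /andP[k0 kn] VV BV /upper_box_dim_lt Bs; rewrite leNgt; apply/negP => sk.
have [c c0 cB] := exists_pos_le BV.
have n4 : 0 < (4 * n%:R) ^+ k :> R.
  by rewrite exprn_gt0// mulr_gt0// ltr0n (leq_trans k0).
(* The summand 1 makes the threshold strictly larger than [(4 * n) ^ k / c], the bound on [u] proved
   below. *)
have := near_at_right0_powR ((4 * n%:R) ^+ k / c + 1) (_ : 0 < k%:R - s).
rewrite subr_gt0 => /(_ sk) small.
have : \forall r \near (0 : R)^'+, [/\
    (covering_number B r <= (r `^ (- s))%:E)%E,
    (4 * n%:R) ^+ k / c + 1 <= r `^ (- (k%:R - s)) & 0 < r < 1].
  by near=> r; split; near: r; last exact: near_at_right0_lt1.
move=> near_r; have [r [Br rsmall /andP[r0 r1]]] :=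
  @filter_ex _ _ (at_right_proper_filter (0 : R)) _ near_r.
have [N [q [Ns Bq]]] := covering_number_le_ex Br.
have [T [t [b [b_inj _ _ BT]]]] :=
  @exists_separated _ _ _ _ q r B p V k0 (ltW r0) VV Bq.
have {BT cB} := le_trans cB BT; rewrite lee_fin.
rewrite (_ : 2 * (n%:R * (2 * r)) = (4 * n%:R) * r); last by ring.
rewrite exprMn => cT.
have TN : T%:R <= r `^ (- s).
  apply: le_trans Ns; rewrite ler_nat.
  by have := leq_card b b_inj; rewrite !card_ord.
move: rsmall; set u := r `^ _ => rsmall.
have ru : r `^ (- s) * r ^+ k * u = 1.
  rewrite -powR_mulrn ?(ltW r0)// /u -!powRD ?(gt_eqF r0) ?implybT//.
  by rewrite (_ : _ - _ = 0) ?powRr0//; ring.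
have rk0 : 0 < r ^+ k by rewrite exprn_gt0.
have u0 : 0 < u by rewrite powR_gt0.
have cu : c * u <= (4 * n%:R) ^+ k.
  apply: le_trans (ler_wpM2r (ltW u0) cT) _.
  apply: (@le_trans _ _ ((4 * n%:R) ^+ k * (r `^ (- s) * r ^+ k * u))).
    rewrite [leRHS]mulrA [X in _ <= X * u]mulrCA.
    by rewrite !ler_wpM2r ?mulr_ge0// ltW.
  by rewrite ru mulr1.
have : c * ((4 * n%:R) ^+ k / c + 1) <= (4 * n%:R) ^+ k.
  by apply: le_trans cu; rewrite ler_wpM2l// ltW.
rewrite mulrDr mulr1 mulrC divfK ?gt_eqF//; lra.
Unshelve. all: by end_near. Qed.

(** * Countable decomposition and packing dimension *)

Lemma positive_outer_bigcup (R : realType) k (A : set 'rV[R]_k)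
    (B : nat -> set 'rV[R]_k) :
  A `<=` \bigcup_i B i -> (0 < lebesgue_outer A)%E ->
  exists i, (0 < lebesgue_outer (B i))%E.
Proof.
move=> AB A0; apply: contrapT => /forallNP B0.
move: A0; rewrite ltNge => /negP; apply.
apply: le_trans (le_lebesgue_outer AB) _.
by apply: lebesgue_outer_bigcup_null => i; rewrite leNgt; apply/negP.
Qed.

Lemma bounded_piece (R : realType) n k (B : set 'rV[R]_n) (c rho : R) :
  bounded_set (piece k B c rho).
Proof.
rewrite /bounded_set /bounded_near; near=> M => x [xrho _].
apply: le_trans xrho _.
by near: M; apply: nbhs_pinfty_ge; rewrite num_real.
Unshelve. all: by end_near. Qed.

Lemma packing_dim_lt (R : realType) n (A : set 'rV[R]_n) (s : \bar R) :
  (packing_dim A < s)%E -> exists B : nat -> set 'rV[R]_n,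
    [/\ forall i, bounded_set (B i), A `<=` \bigcup_i B i &
        forall i, (upper_box_dim (B i) < s)%E].
Proof.
move=> /ereal_inf_lt[_ [B [Bb AB] <-] Bs]; exists B; split => // i.
by apply: le_lt_trans Bs; apply: ereal_sup_ubound; exists i.
Qed.

Lemma packing_dim_le (R : realType) n (A : set 'rV[R]_n)
    (C : nat * nat -> set 'rV[R]_n) (s : \bar R) :
  (forall ij, bounded_set (C ij)) ->
  (forall x, A x -> exists ij, C ij x) ->
  (forall ij, (upper_box_dim (C ij) <= s)%E) -> (packing_dim A <= s)%E.
Proof.
move=> Cb AC Cs; have /card_esym/ppcard_eqP[f] := card_nat2.
apply: (@le_trans _ _ (ereal_sup (range (fun l => upper_box_dim (C (f l)))))).
  apply: ereal_inf_lbound; exists (C \o f) => //; split => [l|x /AC[ij xij]].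
    exact: Cb.
  by exists (f^-1%FUN ij) => //=; rewrite invK ?inE.
by apply: ge_ereal_sup => _ [l _ <-].
Qed.

Lemma packing_dim_plane_extension (R : realType) n k (E : set 'rV[R]_n)
    (s : R) :
  (0 < k <= n)%N -> E <> plane_extension k E -> (packing_dim E < s%:E)%E ->
  (packing_dim (plane_extension k E) <= (2 * s - k%:R)%:E)%E.
Proof.
move=> kn EF /packing_dim_lt[B [Bb EB Bs]].
have posB (P : set 'rV[R]_n) : positive_measure_on k P (E `&` P) ->
    exists p (V : 'M[R]_(k, n)) i, [/\ V *m V^T = 1%:M,
      P = range (affine_param p V) &
      (0 < lebesgue_outer (affine_param p V @^-1` B i))%E].
  move=> [p [V [VV PpV EV]]]; exists p, V.
  have [|i Bi] := positive_outer_bigcup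
      (B := fun i => affine_param p V @^-1` B i) _ EV; last by exists i.
  by move=> t [/EB[i _ Bt] _]; exists i.
(* Otherwise no plane is added at all, and the extension equals [E]. *)
have ks : k%:R <= s.
  apply: contrapT => ks; apply: EF; apply/seteqP.
  split => [x|x [//|]]; first by left.
  move=> [P [_ /posB[p [V [i [VV _ BiV]]]]] _].
  by exfalso; apply: ks; exact: upper_box_dim_ge kn VV BiV (Bs i).
have [rho rhoB] : {rho : nat -> R & forall i,
    1 <= rho i /\ forall y, B i y -> `|y| <= rho i}.
  apply: (@choice _ _ (fun i r => 1 <= r /\ forall y, B i y -> `|y| <= r)) => i.
  have Bi := Bb i.
  have : \forall M \near +oo, 1 <= M /\ forall y, B i y -> `|y| <= M.
    by near=> M; split; near: M => //; apply: nbhs_pinfty_ge; rewrite num_real.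
  exact: (@filter_ex _ _ proper_pinfty_nbhs).
(* Index 0 keeps [B i], which covers [E]; the indices [j.+1] exhaust all lower bounds [c > 0] and
   all radii. *)
pose C ij := if ij.2 is j.+1 then piece k (B ij.1) j.+1%:R^-1 (rho ij.1 + j%:R)
             else B ij.1.
apply: (@packing_dim_le _ _ _ C).
- move=> [i [|j]]; rewrite /C/=; first exact: Bb.
  exact: bounded_piece.
- move=> x [/EB[i _ Bx]|[P [_ /posB[p [V [i [VV PpV BiV]]]]] Px]].
    by exists (i, 0%N).
  have [c c0 cB] := exists_pos_le BiV.
  have ge0 : 0 <= `|x| + c^-1 by rewrite addr_ge0// invr_ge0 ltW.
  (* One [j] serves both conditions: [j.+1] exceeds [c^-1] and the norm of [x], and the latter is
     then below [rho i + j] because [1 <= rho i]. *)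
  pose j := Num.trunc (`|x| + c^-1).
  have := truncn_itv ge0; rewrite -/j => /andP[_ xj].
  have cj : c^-1 < j.+1%:R by apply: le_lt_trans xj; rewrite lerDr.
  exists (i, j.+1); split.
    have [rho1 _] := rhoB i.
    have : `|x| < j.+1%:R by apply: le_lt_trans xj; rewrite lerDl invr_ge0 ltW.
    by rewrite -natr1 => ? /=; lra.
  exists p, V; split => //; first by rewrite -PpV.
  apply: le_trans cB; rewrite lee_fin -[leRHS]invrK.
  by rewrite lef_pV2 ?posrE ?invr_gt0// ltW.
- move=> [i [|j]] /=; rewrite /C /=.
    (* By [ks], [s <= 2 * s - k]. *)
    by apply: le_trans (ltW (Bs i)) _; rewrite lee_fin; lra.
  have [rho1 Brho] := rhoB i.
  apply: upper_box_dim_piece => //.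
  + by apply: le_trans rho1 _; rewrite lerDl.
  + by move=> y /Brho /le_trans; apply; rewrite lerDl.
Unshelve. all: by end_near. Qed.

(** Let [s] decrease to [e]. Working with real [s] leaves the infinite values of the dimensions to
    be treated only here. *)
Lemma lee_twice_sub (R : realType) (d e : \bar R) (k : R) :
  (forall s : R, (e < s%:E)%E -> (d <= (2 * s - k)%:E)%E) ->
  (d <= 2%:E * e - k%:E)%E.
Proof.
case: e => [e||] de; last 2 first.
- by rewrite gt0_muley ?lte_fin// leey.
- rewrite gt0_muleNy ?lte_fin//= leeNy_eq; apply/eqP.
  case: d de => [d||//] de.
    (* This [s] would give [d <= d - 2]. *)
    have := de ((d + k) / 2 - 1) (ltNyr _).
    by rewrite lee_fin => ?; exfalso; lra.
  by have := de 0 (ltNyr _).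
apply/lee_addgt0Pr => f f0; rewrite -EFinM -EFinB -EFinD.
have := de (e + f / 2); rewrite lte_fin ltrDl divr_gt0// => /(_ isT).
by move=> /le_trans; apply; rewrite lee_fin; lra.
Qed.

Unset Implicit Arguments.

Theorem theorem3 (R : realType) (n k : nat) (hk : (1 <= k)%N) (hkn : (k <= n)%N)
    (E F : set 'rV[R]_n) (hF : F = plane_extension k E) :
  E = F \/
  (packing_dim F <= 2%:E * packing_dim E - (k%:R)%:E)%E.
Proof.
have [EF|EF] := pselect (E = F); [by left|right]; subst F.
apply: lee_twice_sub => s Es.
by apply: packing_dim_plane_extension => //; rewrite hk.
Qed.
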